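(* Let $(X,f)$ be a dynamical system and let $\alpha\in[0,1)$. The following statements are equivalent: (1) $(X,f)$ has the $\mathscr{M}_{\alpha}$-shadowing property; (2) for every $\varepsilon>0$ and every asymptotic average pseudo-orbit $\{x_i\}_{i=0}^\infty$ of $f$, there exists $z\in X$ such that $\{x_i\}_{i=0}^\infty$ is $\mathscr{M}_{\alpha}$-$\varepsilon$-shadowed by $z$; (3) for every $\varepsilon>0$, there exists $\delta>0$ such that every $\delta$-average-pseudo-orbit of $f$ is $\mathscr{M}_{\alpha}$-$\varepsilon$-shadowed by some point in $X$; (4) for every $\varepsilon>0$, there exists $\delta>0$ such that every $\delta$-asymptotic-average-pseudo-orbit of $f$ is $\mathscr{M}_{\alpha}$-$\varepsilon$-shadowed by some point in $X$.
   Context: $\mathbb{N}_0=\{0,1,2,\dots\}$. A dynamical system $(X,f)$ is a compact metric space $(X,d)$ together with a continuous map $f\colon X\to X$. For $A\subset\mathbb{N}_0$, $\underline{d}(A)=\liminf_{n\to\infty}\frac1n|A\cap\{0,\dots,n-1\}|$. A sequence $\{x_i\}_{i=0}^\infty\subset X$ is: a $\delta$-ergodic pseudo-orbit of $f$ if $\lim_{n\to\infty}\frac1n|\{0\le i<n: d(f(x_i),x_{i+1})\ge\delta\}|=0$; a $\delta$-average-pseudo-orbit if there is $N>0$ such that $\frac1n\sum_{i=0}^{n-1}d(f(x_{i+k}),x_{i+k+1})<\delta$ for all $n\ge N$ and all integers $k\ge0$; a $\delta$-asymptotic-average-pseudo-orbit if $\limsup_{n\to\infty}\frac1n\sum_{i=0}^{n-1}d(f(x_i),x_{i+1})<\delta$;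 an asymptotic average pseudo-orbit if $\lim_{n\to\infty}\frac1n\sum_{i=0}^{n-1}d(f(x_i),x_{i+1})=0$. A sequence $\{x_i\}_{i=0}^\infty$ is $\mathscr{M}_{\alpha}$-$\varepsilon$-shadowed by $z\in X$ if $\underline{d}(\{i\in\mathbb{N}_0: d(f^i(z),x_i)<\varepsilon\})>\alpha$. $(X,f)$ has the $\mathscr{M}_{\alpha}$-shadowing property if for every $\varepsilon>0$ there is $\delta>0$ such that every $\delta$-ergodic pseudo-orbit of $f$ is $\mathscr{M}_{\alpha}$-$\varepsilon$-shadowed by some point of $X$. *)

(* Defs.v *)
From mathcomp Require Import all_boot all_order all_algebra.
From mathcomp Require Import all_classical all_reals all_analysis.

Set Implicit Arguments.
Unset Strict Implicit.
Unset Printing Implicit Defensive.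

Import Order.TTheory GRing.Theory Num.Theory.
Import numFieldNormedType.Exports.

Local Open Scope classical_set_scope.
Local Open Scope ring_scope.

(** [freq A n] is #|{i < n : i in A}| / n; the junk value at [n = 0] is
    irrelevant since only the behaviour as [n] tends to infinity is used. *)
Definition freq {R : realType} (A : set nat) (n : nat) : R :=
  n%:R^-1 * #|[pred i : 'I_n | (i : nat) \in A]|%:R.

(** Lower limits (and upper limits below) are taken in the extended reals, so
    that they are meaningful without any boundedness side condition. *)
Definition lower_density {R : realType} (A : set nat) : \bar R :=
  limn_einf (fun n => (freq A n)%:E).

Section PseudoOrbits.
Context {R : realType} {X : metricType R}.
Implicit Types (f : X -> X) (x : nat -> X) (delta eps alpha : R) (z : X).

Definition jump f x (i : nat) : R := mdist (f (x i)) (x i.+1).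

Definition mean_jump f x (k n : nat) : R :=
  n%:R^-1 * \sum_(i < n) jump f x (i + k)%N.

Definition ergodic_pseudo_orbit f delta x : Prop :=
  freq [set i | delta <= jump f x i] n @[n --> \oo] --> (0 : R).

Definition average_pseudo_orbit f delta x : Prop :=
  exists2 N : nat, (0 < N)%N &
    forall n k : nat, (N <= n)%N -> mean_jump f x k n < delta.

Definition delta_asymptotic_average_pseudo_orbit f delta x : Prop :=
  (limn_esup (fun n => (mean_jump f x 0 n)%:E) < delta%:E)%E.

Definition asymptotic_average_pseudo_orbit f x : Prop :=
  mean_jump f x 0 n @[n --> \oo] --> (0 : R).

Definition M_shadowed f alpha eps x z : Prop :=
  (alpha%:E <
     lower_density [set i | (mdist (iter i f z) (x i) < eps)%R])%E.

Definition M_shadowing_property f alpha : Prop :=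
  forall eps, 0 < eps -> exists2 delta, 0 < delta &
    forall x, ergodic_pseudo_orbit f delta x ->
      exists z, M_shadowed f alpha eps x z.

End PseudoOrbits.

(* Main.v *)
Require Import Defs.
From mathcomp Require Import all_boot all_order all_algebra.
From mathcomp Require Import all_classical all_reals all_analysis.
From mathcomp Require Import ring lra zify.

Import Order.TTheory GRing.Theory Num.Theory.
Import numFieldNormedType.Exports.

Local Open Scope classical_set_scope.
Local Open Scope ring_scope.

(** Call the four conditions ergodic, asymptotic, average and delta-asymptotic,
    after the pseudo-orbits in them, and let [D] bound the distances in the
    compact space [X].  The cycle in the theorem goes through the implications
    ergodic => asymptotic => delta-asymptotic => average and
    average => asymptotic, delta-asymptotic => ergodic.

    Three of these compare pseudo-orbits directly.  By Markov's inequality an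
    asymptotic average pseudo-orbit is [delta]-ergodic for every [delta > 0]
    ([asymptotic_average_ergodic]).  Rare jumps of size at most [D] contribute
    nothing to the limit of the means, so a [delta/2]-ergodic pseudo-orbit is a
    [delta]-asymptotic-average one ([ergodic_delta_asymptotic_average]), and so
    is a [delta/2]-average one ([average_delta_asymptotic_average]).

    average => asymptotic: the mean jump of an asymptotic average pseudo-orbit
    [x] tends to 0, but not uniformly in the starting time.  Cut time into blocks
    of a large fixed length [N], and replace [x] by a true orbit on each block
    whose mean jump exceeds [eta].  On every block the sum of the jumps is now at
    most [eta * N + D], so this is an average pseudo-orbit ([repair_average]).
    The modified blocks have density zero, since the sum of the first [n] jumps
    of [x] is o(n) ([sum_bad_block_le]).  As changes on a set of density zero do
    not affect lower densities ([M_shadowed_of_agree]), a point shadowing the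
    new sequence also shadows [x], and the strict bound [alpha] is not lost
    ([asymptotic_shadowing_of_average]).  The same repair would change a
    [delta]-asymptotic-average pseudo-orbit on a set of positive density and lose
    part of [alpha]; this is why average => delta-asymptotic has to pass through
    the asymptotic condition.

    asymptotic => delta-asymptotic, by contradiction: for each [k] take a
    [1/(k+1)]-asymptotic-average pseudo-orbit [xs k] that no point shadows at
    scale [eps].  By compactness the failure is uniform: for [M] as large as
    desired there is [L] such that every point tracks [xs k] at scale [eps/2] for
    a proportion at most [alpha + 1/(k+1)] of an initial segment whose length
    lies between [M] and [L] ([uniform_escape]).  Concatenate initial segments of
    the [xs k] with rapidly growing lengths.  The result is an asymptotic average
    pseudo-orbit ([concatenation_sublinear]), but for every point there are
    arbitrarily large [k] and times at which the proportion of tracking is at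
    most [alpha + 2/(k+1)], so no point shadows it at scale [eps/2]
    ([delta_shadowing_of_asymptotic]). *)

(** * Means, lower and upper limits as eventual bounds on sums *)

Lemma mean_leP {R : realType} (c s : R) (n : nat) : (0 < n)%N ->
  (n%:R^-1 * s <= c) = (s <= c * n%:R).
Proof. by move=> n0; rewrite mulrC ler_pdivrMr ?ltr0n. Qed.

Lemma mean_geP {R : realType} (c s : R) (n : nat) : (0 < n)%N ->
  (c <= n%:R^-1 * s) = (c * n%:R <= s).
Proof. by move=> n0; rewrite [leRHS]mulrC ler_pdivlMr ?ltr0n. Qed.

(** Multiplying out [n%:R^-1] turns limits of means into eventual bounds on sums,
    which add up and split without divisions. *)
Lemma cvg_mean0P {R : realType} (s : nat -> R) : (forall n, 0 <= s n) ->
  n%:R^-1 * s n @[n --> \oo] --> (0 : R) <->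
  forall e, 0 < e -> \forall n \near \oo, s n <= e * n%:R.
Proof.
move=> s0; split=> [/cvgr0Pnorm_le h e /h {}h|h].
  near=> n; rewrite -mean_leP; last by near: n; exact: nbhs_infty_gt.
  by rewrite (le_trans (ler_norm _))//; near: n.
apply/cvgr0Pnorm_le => e /h {}h; near=> n.
rewrite ger0_norm ?mulr_ge0 ?invr_ge0//.
rewrite mean_leP; last by near: n; exact: nbhs_infty_gt.
by near: n.
Unshelve. all: by end_near. Qed.

(** The strictness of the inequality leaves room for a real number strictly
    between the two sides; this is what later absorbs errors of density zero. *)
Lemma lt_limn_einfP {R : realType} (u : nat -> R) (a : R) :
  (a%:E < limn_einf (EFin \o u))%E <->
  exists2 c, a < c & \forall n \near \oo, c <= u n.
Proof.
rewrite limn_einf_lim.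
have -> : limn (einfs (EFin \o u)) = ereal_sup (range (einfs (EFin \o u))).
  by apply/cvg_lim => //; exact: cvg_einfs_sup.
split.
  move=> /ereal_sup_gt[_ [N _ <-]] aN.
  have [c ac cN] : exists2 c : R, a < c & (c%:E <= einfs (EFin \o u) N)%E.
    move: aN; case: (einfs _ N) => [r||]//; first by exists r.
    by exists (a + 1); rewrite ?ltrDl// leey.
  exists c => //; exists N => // n /= Nn.
  rewrite -lee_fin (le_trans cN)//; apply: ereal_inf_lbound.
  by exists n.
move=> [c ac [N _ cu]]; rewrite (@lt_le_trans _ _ c%:E) ?lte_fin//.
apply: le_trans (ereal_sup_ubound _); last by exists N.
by apply: le_ereal_inf_tmp => _ [n /= Nn <-]; rewrite lee_fin cu.
Qed.

Lemma limn_esup_ltP {R : realType} (u : nat -> R) (a : R) :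
  (limn_esup (EFin \o u) < a%:E)%E <->
  exists2 c, c < a & \forall n \near \oo, u n <= c.
Proof.
have -> : limn_esup (EFin \o u) = (- limn_einf (EFin \o (fun n => - u n)%R))%E.
  by rewrite -limn_esupN; congr limn_esup; apply/funext => n /=; rewrite opprK.
rewrite lteNl -EFinN lt_limn_einfP; split=> -[c ac h]; exists (- c).
- by rewrite ltrNl.
- by near=> n; rewrite lerNr; near: n.
- by rewrite ltrN2.
- by near=> n; rewrite lerN2; near: n.
Unshelve. all: by end_near. Qed.

Lemma lt_limn_einf_meanP {R : realType} (s : nat -> R) (a : R) :
  (a%:E < limn_einf (fun n => (n%:R^-1 * s n)%:E))%E <->
  exists2 c, a < c & \forall n \near \oo, c * n%:R <= s n.
Proof.
rewrite (lt_limn_einfP (fun n => n%:R^-1 * s n)).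
split=> -[c ac h]; exists c => //.
- near=> n; rewrite -mean_geP; last by near: n; exact: nbhs_infty_gt.
  by near: n.
- near=> n; rewrite mean_geP; last by near: n; exact: nbhs_infty_gt.
  by near: n.
Unshelve. all: by end_near. Qed.

Lemma limn_esup_mean_ltP {R : realType} (s : nat -> R) (a : R) :
  (limn_esup (fun n => (n%:R^-1 * s n)%:E) < a%:E)%E <->
  exists2 c, c < a & \forall n \near \oo, s n <= c * n%:R.
Proof.
rewrite (limn_esup_ltP (fun n => n%:R^-1 * s n)).
split=> -[c ac h]; exists c => //.
- near=> n; rewrite -mean_leP; last by near: n; exact: nbhs_infty_gt.
  by near: n.
- near=> n; rewrite mean_leP; last by near: n; exact: nbhs_infty_gt.
  by near: n.
Unshelve. all: by end_near. Qed.

Lemma freqE {R : realType} (A : set nat) (n : nat) :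
  freq A n = n%:R^-1 * \sum_(i < n) \1_A (i : nat) :> R.
Proof.
rewrite /freq -sum1_card natr_sum big_mkcond; congr (_ * _).
by apply: eq_bigr => i _; rewrite indicE inE; case: ifP.
Qed.

(** * Pseudo-orbits and shadowing in terms of sums *)

Section Reformulations.
Context {R : realType} {X : metricType R}.
Implicit Types (f : X -> X) (x : nat -> X) (e delta eps alpha : R) (z : X).

Lemma jump_ge0 f x i : 0 <= jump f x i.
Proof. exact: mdist_ge0. Qed.

Lemma mean_jump0E f x n :
  mean_jump f x 0 n = n%:R^-1 * \sum_(i < n) jump f x i.
Proof.
by rewrite /mean_jump; congr (_ * _); apply: eq_bigr => i _; rewrite addn0.
Qed.

Definition tracking f eps x z := [set i | mdist (iter i f z) (x i) < eps].

Lemma ergodicP f delta x : ergodic_pseudo_orbit f delta x <->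
  forall e, 0 < e -> \forall n \near \oo,
    \sum_(i < n) \1_[set i | delta <= jump f x i] (i : nat) <= e * n%:R.
Proof.
rewrite /ergodic_pseudo_orbit; under eq_fun do rewrite freqE.
by apply: cvg_mean0P => n; apply: sumr_ge0 => i _; rewrite indicE.
Qed.

Lemma asymptotic_averageP f x : asymptotic_average_pseudo_orbit f x <->
  forall e, 0 < e -> \forall n \near \oo,
    \sum_(i < n) jump f x i <= e * n%:R.
Proof.
rewrite /asymptotic_average_pseudo_orbit; under eq_fun do rewrite mean_jump0E.
by apply: cvg_mean0P => n; apply: sumr_ge0 => i _; exact: jump_ge0.
Qed.

Lemma delta_asymptotic_averageP f delta x :
  delta_asymptotic_average_pseudo_orbit f delta x <->
  exists2 c, c < delta & \forall n \near \oo,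
    \sum_(i < n) jump f x i <= c * n%:R.
Proof.
rewrite /delta_asymptotic_average_pseudo_orbit.
under eq_fun do rewrite mean_jump0E.
exact: limn_esup_mean_ltP.
Qed.

Lemma M_shadowedP f alpha eps x z : M_shadowed f alpha eps x z <->
  exists2 c, alpha < c & \forall n \near \oo,
    c * n%:R <= \sum_(i < n) \1_(tracking f eps x z) (i : nat).
Proof.
rewrite /M_shadowed /lower_density; under eq_fun do rewrite freqE.
exact: lt_limn_einf_meanP.
Qed.

Lemma near_mdist_lt (y : X) e : 0 < e -> \forall y' \near y, mdist y y' < e.
Proof. by move=> e0; have := nbhsx_ballx y e e0; rewrite ballEmdist. Qed.

(** Local boundedness of the distance to [a] becomes global by compactness, in
    its form exchanging a finite cover for a filter of bounds. *)
Lemma compact_bounded_mdist (a : X) : compact [set: X] ->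
  exists2 D : R, 0 < D & forall x y : X, mdist x y <= D.
Proof.
move=> /compact_near_coveringP/(_ nat \oo (fun n y => mdist a y <= n%:R)).
case=> [y _|N _ /(_ N (leqnn _)) h].
  have : \forall y' \near y & n \near \oo,
      mdist y y' < 1 /\ mdist a y + 1 <= n%:R.
    exists ([set y' | mdist y y' < 1], [set n | mdist a y + 1 <= n%:R]).
      split; last exact: nbhs_infty_ger.
      exact: near_mdist_lt.
    by move=> [y' n] [].
  apply: filterS => -[y' n] /= [yy' an].
  by rewrite (le_trans (metric_triangle _ y _))// (le_trans _ an)// lerD2l ltW.
exists (N%:R + N%:R + 1) => [|x y]; first by rewrite ltr_wpDl ?addr_ge0.
rewrite (le_trans (metric_triangle _ a _))// ler_wpDr// lerD// ?h//.
by rewrite metric_sym h.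
Qed.

End Reformulations.

(** * Comparison of the notions of pseudo-orbit *)

Section Comparison.
Context {R : realType} {X : metricType R}.
Implicit Types (f : X -> X) (x : nat -> X) (e delta eps alpha : R) (z : X).

(** Markov's inequality: each index with a jump of size at least [delta]
    contributes at least [delta] to the sum of jumps. *)
Lemma asymptotic_average_ergodic f delta x : 0 < delta ->
  asymptotic_average_pseudo_orbit f x -> ergodic_pseudo_orbit f delta x.
Proof.
move=> d0 /asymptotic_averageP h; apply/ergodicP => e e0.
have := h (delta * e) (mulr_gt0 d0 e0); apply: filterS => n.
rewrite -mulrA => hn; rewrite -(ler_pM2l d0); apply: le_trans hn.
rewrite mulr_sumr; apply: ler_sum => i _; rewrite indicE.
case: (boolP (_ \in _)); first by rewrite inE /= mulr1.
by rewrite mulr0 jump_ge0.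
Qed.

(** A jump is below [delta / 2] except on a set of density zero, where it is
    bounded by the diameter of [X]; so the mean is eventually below any number
    larger than [delta / 2]. *)
Lemma ergodic_delta_asymptotic_average f delta x : compact [set: X] ->
  0 < delta -> ergodic_pseudo_orbit f (delta / 2) x ->
  delta_asymptotic_average_pseudo_orbit f delta x.
Proof.
move=> cX d0 /ergodicP h.
have [D D0 xD] := compact_bounded_mdist (x 0%N) cX.
apply/delta_asymptotic_averageP; exists (delta / 2 + delta / 4); first by lra.
have eD0 : 0 < delta / 4 / D by rewrite !divr_gt0.
have := h _ eD0; apply: filterS => n hn.
have hD : D * (\sum_(i < n) \1_[set i | delta / 2 <= jump f x i] (i : nat))
    <= delta / 4 * n%:R.
  by rewrite mulrC -ler_pdivlMr// -mulrAC.
rewrite mulrDl; apply: le_trans (lerD (lexx _) hD).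
rewrite -[X in _ * X%:R]card_ord -sum1_card natr_sum !mulr_sumr -big_split/=.
apply: ler_sum => i _; rewrite indicE.
case: (boolP (_ \in _)) => [_|].
  by rewrite !mulr1 (le_trans (xD _ _))// lerDr divr_ge0// ltW.
by rewrite notin_setE /= mulr1 mulr0 addr0 => /negP; rewrite -ltNge => /ltW.
Qed.

(** Halving [delta] turns the strict inequalities, which survive in the limit
    only as weak ones, into a strict inequality for the upper limit. *)
Lemma average_delta_asymptotic_average f delta x : 0 < delta ->
  average_pseudo_orbit f (delta / 2) x ->
  delta_asymptotic_average_pseudo_orbit f delta x.
Proof.
move=> d0 [N N0 h]; apply/delta_asymptotic_averageP.
exists (delta / 2); first by lra.
exists N => // n /= Nn; rewrite -mean_leP ?(leq_trans N0)//.
by rewrite -mean_jump0E ltW// h.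
Qed.

End Comparison.

(** * Sums over blocks of fixed length *)

Section Blocks.
Context {R : realType}.
Implicit Types (u v : nat -> R) (N : nat).

Lemma sum_blocksE u N q :
  \sum_(i < q * N) u i = \sum_(b < q) \sum_(j < N) u (b * N + j)%N.
Proof.
elim: q => [|q IH]; first by rewrite mul0n !big_ord0.
by rewrite mulSn addnC big_split_ord big_ord_recr /= IH.
Qed.

(** A window of length [n], wherever it starts, is covered by [n %/ N + 2]
    consecutive blocks of length [N].  The bound does not depend on the start
    [k], which provides the uniformity asked from an average pseudo-orbit. *)
Lemma sum_window_le u N B k n : (0 < N)%N -> (forall i, 0 <= u i) ->
  (forall b, \sum_(j < N) u (b * N + j)%N <= B) ->
  \sum_(i < n) u (i + k)%N <= (n %/ N + 2)%:R * B.
Proof.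
move=> N0 u0 uB; set b0 := (k %/ N)%N; set q := (n %/ N + 2)%N.
have kb : (b0 * N <= k)%N by exact: leq_divM.
have knb : (k - b0 * N + n <= q * N)%N.
  have := ltn_ceil k N0; have := ltn_ceil n N0; rewrite -/b0 /q; nia.
pose v i := u (b0 * N + i)%N.
have -> : \sum_(i < n) u (i + k)%N = \sum_(i < n) v (k - b0 * N + i)%N.
  by apply: eq_bigr => i _; rewrite /v; congr u; lia.
have le1 : \sum_(i < n) v (k - b0 * N + i)%N <= \sum_(i < q * N) v i.
  rewrite -(subnKC knb) big_split_ord /= big_split_ord /=.
  rewrite addrAC ler_wpDl//.
  by apply: addr_ge0; apply: sumr_ge0 => i _; exact: u0.
rewrite (le_trans le1)// sum_blocksE.
have le2 b : \sum_(j < N) v (b * N + j)%N <= B.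
  rewrite (le_trans _ (uB (b0 + b)%N))//.
  by apply: ler_sum => j _; rewrite /v mulnDl addnA.
apply: (@le_trans _ _ (\sum_(b < q) B)).
  by apply: ler_sum => b _; exact: le2.
by rewrite sumr_const card_ord mulr_natl.
Qed.

Definition bad_block u N (eta : R) (b : nat) : bool :=
  eta * N%:R < \sum_(j < N) u (b * N + j)%N.

(** Markov's inequality blockwise: the [N] indices of a bad block are paid for by
    a sum larger than [eta * N] over that block.  The term [D * N%:R] accounts
    for the last block, which may extend beyond [n]. *)
Lemma sum_bad_block_le u N eta D n : (0 < N)%N -> 0 <= eta ->
  (forall i, 0 <= u i) -> (forall i, u i <= D) ->
  eta * \sum_(i < n) \1_[set i | bad_block u N eta (i %/ N)] (i : nat) <=
  \sum_(i < n) u i + D * N%:R.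
Proof.
move=> N0 eta0 u0 uD; set E := [set i | _].
pose q := (n %/ N).+1.
have nq : (n <= q * N)%N by rewrite ltnW// ltn_ceil.
have qn : (q * N - n <= N)%N by have := leq_divM n N; rewrite /q; nia.
have le1 : \sum_(i < n) \1_E (i : nat) <= \sum_(i < q * N) \1_E (i : nat) :> R.
  by rewrite -(subnKC nq) big_split_ord/= lerDl; apply: sumr_ge0.
have le2 : \sum_(i < q * N) u i <= \sum_(i < n) u i + D * N%:R.
  rewrite -(subnKC nq) big_split_ord/= lerD2l.
  apply: (@le_trans _ _ (\sum_(i < q * N - n) D)); first exact: ler_sum.
  rewrite sumr_const card_ord -[leLHS]mulr_natr ler_wpM2l ?ler_nat//.
  exact: le_trans (u0 0%N) (uD 0%N).
rewrite (le_trans (ler_wpM2l eta0 le1))// (le_trans _ le2)// !sum_blocksE.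
rewrite mulr_sumr; apply: ler_sum => b _.
have idx (j : 'I_N) : ((b * N + j) %/ N = b)%N.
  by rewrite divnMDl// divn_small ?addn0.
under eq_bigr do rewrite indicE.
have [bb|bb] := boolP (bad_block u N eta b).
  rewrite (le_trans _ (ltW bb))// ler_wpM2l//.
  rewrite -[X in _ <= X%:R]card_ord -sum1_card natr_sum ler_sum// => j _.
  by rewrite lern1 leq_b1.
rewrite big1 ?mulr0 ?sumr_ge0// => j _.
by rewrite memNset//= /E/= idx; apply/negP.
Qed.

End Blocks.

(** * Repairing an asymptotic average pseudo-orbit *)

Section Repair.
Context {R : realType} {X : metricType R}.
Implicit Types (f : X -> X) (x : nat -> X) (e delta eps alpha : R) (z : X).

Definition repair f x N (eta : R) : nat -> X := fun i =>
  if bad_block (jump f x) N eta (i %/ N) then iter (i %% N) f (x (i %/ N * N)%N)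
  else x i.

Lemma repair_start f x N eta b : (0 < N)%N ->
  repair f x N eta (b * N)%N = x (b * N)%N.
Proof. by move=> N0; rewrite /repair mulnK// modnMl if_same. Qed.

(** Inside a bad block the repaired sequence is a true orbit, so its only jump is
    the one into the next block; a block that is not bad is unchanged, and since
    every block keeps its first point, so is the jump leaving it. *)
Lemma repair_block f x N eta D b : (0 < N)%N -> 0 <= eta ->
  (forall y y' : X, mdist y y' <= D) ->
  \sum_(j < N) jump f (repair f x N eta) (b * N + j)%N <= eta * N%:R + D.
Proof.
move=> N0 eta0 xD; set y := repair _ _ _ _.
have D0 : 0 <= D by exact: le_trans (mdist_ge0 _ _) (xD (x 0%N) (x 0%N)).
have etaN : 0 <= eta * N%:R by rewrite mulr_ge0.
have yE j : (j < N)%N -> y (b * N + j)%N =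
    if bad_block (jump f x) N eta b then iter j f (x (b * N)%N)
    else x (b * N + j)%N.
  move=> jN; rewrite /y /repair divnMDl// divn_small// addn0.
  by rewrite modnMDl modn_small.
case bb : (bad_block (jump f x) N eta b) yE => yE.
  case: N N0 y yE {bb etaN} => // N _ y yE.
  rewrite big_ord_recr /= big1 ?add0r; last first.
    move=> j _; rewrite /jump -addnS !yE ?ltnS// 1?ltnW// ?mdistxx//.
  rewrite (le_trans (xD _ _))// lerDr mulr_ge0//.
have -> : \sum_(j < N) jump f y (b * N + j)%N =
    \sum_(j < N) jump f x (b * N + j)%N.
  apply: eq_bigr => j _; rewrite /jump yE//.
  have [jN|jN] := ltnP j.+1 N; first by rewrite -addnS yE.
  have -> : ((b * N + j).+1 = b.+1 * N)%N by have := ltn_ord j; lia.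
  by rewrite /y repair_start.
by rewrite ler_wpDr// leNgt -/(bad_block _ _ _ _) bb.
Qed.

Lemma repair_average f x N eta D delta : (0 < N)%N -> 0 <= eta ->
  (forall y y' : X, mdist y y' <= D) -> eta + D / N%:R < delta ->
  average_pseudo_orbit f delta (repair f x N eta).
Proof.
move=> N0 eta0 xD dlt; set B := eta * N%:R + D.
have D0 : 0 <= D by exact: le_trans (mdist_ge0 _ _) (xD (x 0%N) (x 0%N)).
have NR : 0 < N%:R :> R by rewrite ltr0n.
have B0 : 0 <= B by rewrite addr_ge0// mulr_ge0.
have BE : B / N%:R = eta + D / N%:R by rewrite /B; field; rewrite gt_eqF.
pose gap := delta - B / N%:R; have gap0 : 0 < gap by rewrite /gap BE; lra.
have [n0 _ n0P] := nbhs_infty_gtr (2 * B / gap).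
exists n0.+1 => // n k n0n.
have n_gt0 : 0 < n%:R :> R by rewrite ltr0n; lia.
have nB : 2 * B < gap * n%:R.
  by have := n0P n (ltnW n0n); rewrite /= ltr_pdivrMr// (mulrC gap).
rewrite /mean_jump mulrC ltr_pdivrMr//.
have := @sum_window_le _ (jump f (repair f x N eta)) N B k n N0 (jump_ge0 _ _)
  (fun b => @repair_block f x N eta D b N0 eta0 xD).
move=> /le_lt_trans; apply.
rewrite natrD mulrDl.
have qn : (n %/ N)%:R * B <= n%:R * (B / N%:R).
  rewrite [leRHS]mulrCA [leLHS]mulrC ler_wpM2l//.
  by rewrite ler_pdivlMr// -natrM ler_nat leq_divM.
by rewrite /gap in nB; lra.
Qed.

(** Lower density is insensitive to a set of density zero, so shadowing with the
    same strict bound [alpha] passes from [y] to [x]. *)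
Lemma M_shadowed_of_agree f alpha eps x y z :
  (forall e, 0 < e -> \forall n \near \oo,
    \sum_(i < n) \1_[set i | y i <> x i] (i : nat) <= e * n%:R) ->
  M_shadowed f alpha eps y z -> M_shadowed f alpha eps x z.
Proof.
move=> xy /M_shadowedP[c ac hc]; apply/M_shadowedP.
exists ((alpha + c) / 2); first by lra.
have e0 : 0 < (c - alpha) / 2 by lra.
have xye := xy _ e0.
near=> n.
have h1 : c * n%:R <= \sum_(i < n) \1_(tracking f eps y z) (i : nat) by near: n.
have h2 : \sum_(i < n) \1_[set i | y i <> x i] (i : nat) <=
   (c - alpha) / 2 * n%:R by near: n.
have h3 : \sum_(i < n) \1_(tracking f eps y z) (i : nat) <=
   \sum_(i < n) \1_(tracking f eps x z) (i : nat) +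
   \sum_(i < n) \1_[set i | y i <> x i] (i : nat) :> R.
  rewrite -big_split; apply: ler_sum => i _ /=; rewrite !indicE -natrD ler_nat.
  have [yx|yx] := pselect (y i = x i).
    have -> : ((i : nat) \in tracking f eps y z) =
        ((i : nat) \in tracking f eps x z).
      by apply/idP/idP; rewrite !inE /tracking /= yx.
    by rewrite leq_addr.
  rewrite (mem_set (yx : [set i | y i <> x i] i)).
  by rewrite (leq_trans (leq_b1 _))// leq_addl.
lra.
Unshelve. all: by end_near. Qed.

(** Repair [x] on the blocks with mean jump above [delta / 2], with blocks so
    long that the single jump per repaired block costs less than [delta / 2] on
    average.  The repaired blocks have density zero, since the sum of jumps of
    [x] is sublinear. *)
Lemma asymptotic_shadowing_of_average f alpha eps delta :
  compact [set: X] -> 0 < delta ->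
  (forall x, average_pseudo_orbit f delta x ->
    exists z, M_shadowed f alpha eps x z) ->
  forall x, asymptotic_average_pseudo_orbit f x ->
    exists z, M_shadowed f alpha eps x z.
Proof.
move=> cX d0 sh x /asymptotic_averageP xa.
have [D D0 xD] := compact_bounded_mdist (x 0%N) cX.
have [N0 _ N0P] := nbhs_infty_gtr (2 * D / delta).
pose N := N0.+1; pose eta := delta / 2.
have eta0 : 0 < eta by rewrite /eta; lra.
have ND : eta + D / N%:R < delta.
  have := N0P N (leqnSn _); rewrite /= ltr_pdivrMr// => h.
  suff : D / N%:R < delta / 2 by rewrite /eta; lra.
  by rewrite ltr_pdivrMr ?ltr0n//; lra.
have [|z zP] := sh (repair f x N eta).
  by apply: (repair_average f x N eta D) => //; exact: ltW.
exists z; apply: M_shadowed_of_agree zP => e e0.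
have e20 : 0 < eta * e / 2 by rewrite divr_gt0 ?mulr_gt0.
have xae := xa _ e20.
near=> n.
have h1 : \sum_(i < n) jump f x i <= eta * e / 2 * n%:R by near: n.
have h2 : D * N%:R / (eta * e / 2) <= n%:R by near: n; exact: nbhs_infty_ger.
rewrite ler_pdivrMr// in h2.
have h3 := @sum_bad_block_le _ (jump f x) N eta D n isT (ltW eta0)
  (jump_ge0 _ _) (fun i => xD _ _).
set E := [set i | bad_block _ _ _ _] in h3.
have h4 : \sum_(i < n) \1_[set i | repair f x N eta i <> x i] (i : nat) <=
    \sum_(i < n) \1_E (i : nat) :> R.
  apply: ler_sum => i _; rewrite !indicE ler_nat.
  case: (boolP (_ \in _)) => //=; rewrite inE /= => yx.
  rewrite mem_set// /E /=; apply: contra_notT yx => bb.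
  by rewrite /repair (negbTE bb).
rewrite (le_trans h4)// -(ler_pM2l eta0) (le_trans h3)//; lra.
Unshelve. all: by end_near. Qed.

End Repair.

(** * Concatenation of segments *)

Section Concatenation.
Context {s : nat -> nat}.
Context (s0 : s 0%N = 0%N) (sS : forall k, (s k < s k.+1)%N).

Lemma start_mono k l : (k <= l)%N -> (s k <= s l)%N.
Proof. by apply: (homo_leq leqnn leq_trans) => i; exact: ltnW. Qed.

Lemma le_start k : (k <= s k)%N.
Proof. by elim: k => // k IH; exact: leq_ltn_trans IH (sS k). Qed.

Lemma ex_segment i : exists k, (s k <= i < s k.+1)%N.
Proof.
elim: i => [|i [k /andP[ki ik]]].
  by exists 0%N; have := sS 0%N; rewrite s0.
have [h|h] := ltnP i.+1 (s k.+1); first by exists k; rewrite h leqW.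
by exists k.+1; rewrite h (leq_ltn_trans ik).
Qed.

(** The segment number [k] of the concatenation occupies the times from [s k] up
    to [s k.+1], excluded, and is an initial segment of [y k]. *)
Lemma concatenation {T : Type} (y : nat -> nat -> T) :
  exists x : nat -> T,
    forall k j, (s k + j < s k.+1)%N -> x (s k + j)%N = y k j.
Proof.
have [seg segP] := choice ex_segment.
exists (fun i => y (seg i) (i - s (seg i))%N) => k j kj.
have -> : seg (s k + j)%N = k; last by rewrite addKn.
have /andP[h1 h2] := segP (s k + j)%N; set l := seg _ in h1 h2 *.
have [lk|kl|//] := ltngtP l k.
- by have := start_mono _ _ lk; lia.
- by have := start_mono _ _ kl; lia.
Qed.

(** Here [u] stands for the jumps of a concatenation.  The term
    [D * (N k).+1%:R] is the cost of the first [N k] jumps of segment [k], before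
    its mean has settled, and of the jump to the next segment.  Each segment is so long that everything before it,
    together with these costs for itself and for its successor, is a fraction
    [1 / k.+1] of its length.  At a time in segment [k.+1] the sum is thus
    controlled by the complete segment [k]: the current segment may have barely
    started, and its own initial cost is absorbed by the previous one. *)
Lemma concatenation_sublinear {R : realType} (u : nat -> R) (N : nat -> nat) D :
  0 < D -> (forall i, u i <= D) ->
  (forall k j, (s k + j <= s k.+1)%N ->
    \sum_(i < j) u (s k + i)%N <= j%:R / k.+1%:R + D * (N k).+1%:R) ->
  (forall k, (k.+1 * (s k + N k + N k.+1 + 2) <= s k.+1 - s k)%N) ->
  forall e, 0 < e -> \forall n \near \oo, \sum_(i < n) u i <= e * n%:R.
Proof.
move=> D0 uD useg sL e e0.
have [K _ KP] := nbhs_infty_gtr ((D + 1) / e).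
exists (s K.+1) => // n /= Kn.
have [l /andP[ln nl]] := ex_segment n.
have Kl : (K < l)%N.
  rewrite ltnNge; apply/negP => lK.
  by have := start_mono _ _ (lK : (l.+1 <= K.+1)%N); lia.
(* The index of the current segment is written [k.+1], so that the previous
   segment [k] exists and is complete. *)
case: l Kl ln nl => // k; rewrite ltnS => Kk kn nk.
pose L := (s k.+1 - s k)%N; pose j := (n - s k.+1)%N.
have sE : (s k.+1 = s k + L)%N by rewrite subnKC// ltnW.
have nE : n = (s k.+1 + j)%N by rewrite subnKC.
have k0 : 0 < k.+1%:R :> R by rewrite ltr0n.
have part1 : \sum_(i < s k) u i <= D * (s k)%:R.
  apply: (@le_trans _ _ (\sum_(i < s k) D)); first exact: ler_sum.
  by rewrite sumr_const card_ord mulr_natr.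
have part2 : \sum_(i < L) u (s k + i)%N <= L%:R / k.+1%:R + D * (N k).+1%:R.
  by apply: useg; rewrite -sE.
have part3 : \sum_(i < j) u (s k.+1 + i)%N <=
    j%:R / k.+1%:R + D * (N k.+1).+1%:R.
  apply: le_trans (useg _ _ _) _; first by rewrite -nE ltnW.
  by rewrite lerD2r ler_wpM2l// lef_pV2 ?posrE ?ltr0n// ler_nat.
have grow : D * (s k + N k + N k.+1 + 2)%:R <= D * (L%:R / k.+1%:R).
  by rewrite ler_pM2l// ler_pdivlMr// -natrM ler_nat mulnC; exact: sL.
have total : \sum_(i < n) u i <= (D + 1) / k.+1%:R * n%:R.
  have -> : \sum_(i < n) u i = \sum_(i < s k) u i +
      \sum_(i < L) u (s k + i)%N + \sum_(i < j) u (s k.+1 + i)%N.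
    by rewrite nE big_split_ord /=; congr (_ + _); rewrite sE big_split_ord.
  apply: le_trans (lerD (lerD part1 part2) part3) _.
  have nL : (L%:R + j%:R : R) <= n%:R by rewrite -natrD ler_nat nE sE; lia.
  have : (D + 1) / k.+1%:R * (L%:R + j%:R) <= (D + 1) / k.+1%:R * n%:R :> R.
    by rewrite ler_wpM2l// divr_ge0// addr_ge0// ltW.
  apply: le_trans.
  move: grow; rewrite !natrD -!(addn1 (N _)) !natrD.
  have : 0 <= D * (j%:R / k.+1%:R) by rewrite mulr_ge0 ?divr_ge0// ltW.
  by set a := k.+1%:R^-1; lra.
rewrite (le_trans total)// ler_wpM2r// ler_pdivrMr// mulrC -ler_pdivrMr//.
rewrite (le_trans (ltW (KP K (leqnn _))))// ler_nat; lia.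
Qed.

End Concatenation.

(** * Uniform failure of shadowing and the concatenated counterexample *)

Section Escape.
Context {R : realType} {X : metricType R}.
Implicit Types (f : X -> X) (x : nat -> X) (e delta eps alpha : R) (z : X).

Lemma iter_continuous f n : continuous f -> continuous (iter n f).
Proof.
move=> cf; elim: n => [|n IH] z; first exact: cvg_id.
exact: (continuous_comp (IH z) (cf _)).
Qed.

Lemma near_orbit f e m z : continuous f -> 0 < e ->
  \forall z' \near z,
    forall i, (i < m)%N -> mdist (iter i f z) (iter i f z') < e.
Proof.
move=> cf e0; elim: m => [|m IH]; first exact: nearW.
have hm : \forall z' \near z, mdist (iter m f z) (iter m f z') < e.
  by have := iter_continuous f m cf z _ (near_mdist_lt (iter m f z) e e0).
apply: filterS2 IH hm => z' h hm i; rewrite ltnS leq_eqVlt => /orP[/eqP->//|].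
exact: h.
Qed.

(** Not being shadowed by [z] yields one late time [m] at which the tracking
    proportion is below [alpha + eta].  Only finitely many iterates are involved,
    so by continuity the same [m] serves a neighbourhood of [z], at the price of
    halving [eps]; compactness then bounds [m] over all [z]. *)
Lemma uniform_escape f alpha eps eta x M : compact [set: X] -> continuous f ->
  0 < eps -> 0 < eta -> (forall z, ~ M_shadowed f alpha eps x z) ->
  exists L : nat, forall z, exists m : nat, [/\ (M <= m)%N, (m <= L)%N &
    \sum_(i < m) \1_(tracking f (eps / 2) x z) (i : nat) <=
      (alpha + eta) * m%:R].
Proof.
move=> cX cf eps0 eta0 nsh.
pose good (L : nat) z := exists m : nat, [/\ (M <= m)%N, (m <= L)%N &
  \sum_(i < m) \1_(tracking f (eps / 2) x z) (i : nat) <= (alpha + eta) * m%:R].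
suff : \forall L \near \oo, [set: X] `<=` good L.
  by move=> [L _ /(_ L (leqnn _)) h]; exists L => z; exact: h.
move/compact_near_coveringP : cX; apply=> z _.
have [m [Mm hm]] : exists m : nat, (M <= m)%N /\
    \sum_(i < m) \1_(tracking f eps x z) (i : nat) < (alpha + eta) * m%:R.
  apply: contra_notP (nsh z) => h; apply/M_shadowedP; exists (alpha + eta).
    by rewrite ltrDl.
  exists M => // m /= Mm; rewrite leNgt; apply/negP => hm.
  by apply: h; exists m.
have e20 : 0 < eps / 2 by rewrite divr_gt0.
exists ([set z' | forall i, (i < m)%N ->
    mdist (iter i f z) (iter i f z') < eps / 2], [set L | (m <= L)%N]).
  by split; [exact: near_orbit|exact: nbhs_infty_ge].
move=> [z' L] /= [zz' mL]; exists m; split => //.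
apply: le_trans (ltW hm); apply: ler_sum => i _; rewrite !indicE ler_nat.
case: (boolP (_ \in _)) => //; rewrite inE /tracking /= => hi.
rewrite mem_set//= (le_lt_trans (metric_triangle _ (iter i f z') _))//.
by rewrite (splitr eps) ltrD// zz'.
Qed.

(** If no [delta] worked, the sequences refuting [delta = 1 / k.+1] could be
    concatenated into an asymptotic average pseudo-orbit without shadowing
    point. *)
Lemma delta_shadowing_of_asymptotic f alpha eps :
  compact [set: X] -> continuous f -> 0 <= alpha -> 0 < eps ->
  (forall x, asymptotic_average_pseudo_orbit f x ->
    exists z, M_shadowed f alpha (eps / 2) x z) ->
  exists2 delta : R, 0 < delta &
    forall x, delta_asymptotic_average_pseudo_orbit f delta x ->
      exists z, M_shadowed f alpha eps x z.
Proof.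
move=> cX cf a0 eps0 sh; apply: contrapT => nodelta.
have r_gt0 k : 0 < k.+1%:R^-1 :> R by rewrite invr_gt0 ltr0n.
have exx k : exists x,
    delta_asymptotic_average_pseudo_orbit f (k.+1%:R^-1) x /\
    forall z, ~ M_shadowed f alpha eps x z.
  apply: contra_notP nodelta => h; exists k.+1%:R^-1 => // x xk.
  by apply: contra_notP h => h; exists x; split => // z hz; apply: h; exists z.
have [xs xsP] := choice exx.
have exN k : exists N : nat, forall n, (N <= n)%N ->
    \sum_(i < n) jump f (xs k) i <= n%:R / k.+1%:R.
  have [/delta_asymptotic_averageP[c ck [N _ h]] _] := xsP k.
  exists N => n /h /le_trans; apply.
  by rewrite [leRHS]mulrC ler_wpM2r// ltW.
have [N NP] := choice exN.
(* The length of segment [ka.1] depends on its starting time [ka.2], which the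
   escape time has to dominate. *)
have exL (ka : nat * nat) : exists L : nat, forall z, exists m : nat,
    [/\ (ka.1.+1 * (ka.2 + N ka.1 + N ka.1.+1 + 2) <= m)%N, (m <= L)%N &
    \sum_(i < m) \1_(tracking f (eps / 2) (xs ka.1) z) (i : nat) <=
      (alpha + ka.1.+1%:R^-1) * m%:R].
  by apply: uniform_escape => //; exact: (xsP ka.1).2.
have [Lf LfP] := choice exL.
pose s := fix s k := if k is k'.+1 then (s k' + Lf (k', s k'))%N else 0%N.
have sSE k : s k.+1 = (s k + Lf (k, s k))%N by [].
have Lbig k : (k.+1 * (s k + N k + N k.+1 + 2) <= Lf (k, s k))%N.
  by have [m [h1 h2 _]] := LfP (k, s k) (xs 0%N 0%N); exact: leq_trans h1 h2.
have sS k : (s k < s k.+1)%N by rewrite sSE; have := Lbig k; nia.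
have s0 : s 0%N = 0%N by [].
have [x xP] := concatenation s0 sS xs.
have [D D0 xD] := compact_bounded_mdist (xs 0%N 0%N) cX.
have x_asymp : asymptotic_average_pseudo_orbit f x.
  apply/asymptotic_averageP.
  apply: (concatenation_sublinear s0 sS _ N D D0) => [i|k j kj|k].
  - exact: xD.
  (* The last of the [j.+1] jumps may lead into the next segment and is bounded
     by [D]; the others are jumps of [xs k]. *)
  - case: j kj => [_|j kj].
      by rewrite big_ord0 mul0r add0r mulr_ge0// ltW.
    have segj : \sum_(i < j) jump f (xs k) i <=
        j.+1%:R / k.+1%:R + D * (N k)%:R.
      have [Nj|jN] := leqP (N k) j.
        rewrite (le_trans (NP k j Nj))// ler_wpDr ?mulr_ge0 ?(ltW D0)//.
        by rewrite ler_wpM2r ?ler_nat// ltW.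
      apply: (@le_trans _ _ (\sum_(i < j) D)).
        by apply: ler_sum => i _; exact: xD.
      rewrite sumr_const card_ord -[leLHS]mulr_natr ler_wpDl ?divr_ge0//.
      by rewrite ler_pM2l// ler_nat ltnW.
    rewrite big_ord_recr /= -(addn1 (N k)) natrD mulrDr mulr1 addrA.
    rewrite lerD ?xD//; apply: le_trans segj.
    apply: ler_sum => i _; have := ltn_ord i; rewrite /jump => ij.
    by rewrite -addnS !xP//; apply: leq_trans kj; rewrite ltn_add2l ltnS// ltnW.
  - by rewrite sSE addKn.
(* A tracking proportion at least [c > alpha] from time [n0] on contradicts the
   escape of [iter (s k) f z] from [xs k], once [2 / k.+1 < c - alpha]: one
   [1 / k.+1] comes from the escape, the other from the times before [s k]. *)
have [z /M_shadowedP[c ac [n0 _ n0P]]] := sh x x_asymp.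
have ca0 : 0 < c - alpha by lra.
have [K _ KP] := nbhs_infty_gtr (2 / (c - alpha)).
pose k := maxn K n0.
have k2 : 2 / k.+1%:R < c - alpha.
  have := KP k.+1 (leqW (leq_maxl _ _)).
  by rewrite /= ltr_pdivrMr// mulrC -ltr_pdivrMr// ltr0n.
have [m [hm1 hm2 hm3]] := LfP (k, s k) (iter (s k) f z).
rewrite /= in hm1 hm2 hm3.
have n0n : (n0 <= s k + m)%N.
  have := le_start sS k; have : (n0 <= k)%N by exact: leq_maxr.
  by lia.
have := n0P _ n0n; rewrite big_split_ord /=.
have -> : \sum_(i < m) \1_(tracking f (eps / 2) x z) (s k + i)%N =
    \sum_(i < m)
      \1_(tracking f (eps / 2) (xs k) (iter (s k) f z)) (i : nat) :> R.
  apply: eq_bigr => i _; rewrite !indicE; congr (nat_of_bool _)%:R.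
  have skm : (s k + i < s k.+1)%N by rewrite sSE ltn_add2l (leq_trans _ hm2).
  by apply/idP/idP; rewrite !inE /tracking /= xP// (addnC (s k)) iterD.
have head :
    \sum_(i < s k) \1_(tracking f (eps / 2) x z) (i : nat) <= (s k)%:R :> R.
  rewrite -[X in _ <= X%:R]card_ord -sum1_card natr_sum ler_sum// => i _.
  by rewrite indicE ler_nat leq_b1.
have skm : (s k)%:R <= m%:R / k.+1%:R :> R.
  rewrite ler_pdivlMr ?ltr0n// -natrM ler_nat (leq_trans _ hm1)// mulnC.
  by rewrite leq_mul2l -!addnA leq_addr orbT.
have m0 : 0 < m%:R :> R.
  by rewrite ltr0n (leq_trans _ hm1)// muln_gt0 addn2.
have : 2 / k.+1%:R * m%:R < (c - alpha) * m%:R by rewrite ltr_pM2r.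
have : 0 <= c * (s k)%:R by rewrite mulr_ge0// ltW// (le_lt_trans a0).
rewrite natrD; move: hm3 head skm; set q := k.+1%:R^-1.
by move=> *; lra.
Qed.

End Escape.

(** * The equivalence *)

Theorem theorem5p2 (R : realType) (X : metricType R) (f : X -> X)
  (X_compact : compact [set: X]) (f_continuous : continuous f)
  (alpha : R) (alpha_ge0 : 0 <= alpha) (alpha_lt1 : alpha < 1) :
  [<-> M_shadowing_property f alpha;
       forall eps : R, 0 < eps ->
         forall x : nat -> X, asymptotic_average_pseudo_orbit f x ->
           exists z : X, M_shadowed f alpha eps x z;
       forall eps : R, 0 < eps -> exists2 delta : R, 0 < delta &
         forall x : nat -> X, average_pseudo_orbit f delta x ->
           exists z : X, M_shadowed f alpha eps x z;
       forall eps : R, 0 < eps -> exists2 delta : R, 0 < delta &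
         forall x : nat -> X, delta_asymptotic_average_pseudo_orbit f delta x ->
           exists z : X, M_shadowed f alpha eps x z].
Proof.
have asymptotic_delta :
    (forall eps : R, 0 < eps -> forall x, asymptotic_average_pseudo_orbit f x ->
      exists z, M_shadowed f alpha eps x z) ->
    forall eps : R, 0 < eps -> exists2 delta : R, 0 < delta &
      forall x, delta_asymptotic_average_pseudo_orbit f delta x ->
        exists z, M_shadowed f alpha eps x z.
  move=> sh eps eps0; apply: delta_shadowing_of_asymptotic => //.
  by apply: sh; rewrite divr_gt0.
tfae.
- move=> sh eps /sh[delta d0 h] x xa.
  by apply: h; exact: asymptotic_average_ergodic.
- move=> /asymptotic_delta sh eps /sh[delta d0 h].
  exists (delta / 2); first by rewrite divr_gt0.
  by move=> x xa; apply: h; exact: average_delta_asymptotic_average.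
- move=> sh; apply: asymptotic_delta => eps /sh[delta d0 h].
  exact: asymptotic_shadowing_of_average h.
- move=> sh eps /sh[delta d0 h].
  exists (delta / 2); first by rewrite divr_gt0.
  by move=> x xa; apply: h; exact: ergodic_delta_asymptotic_average.
Qed.
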